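(* Let $\alpha,\bar\alpha,\beta,\bar\beta,\gamma,\bar\gamma$ be six independent indeterminates, let $K$ be a field of characteristic $0$ containing them, and let $\Gamma_{n+1}(\alpha,\bar\alpha)=\Gamma_{n+1}(\alpha,\bar\alpha,\beta,\bar\beta,\gamma,\bar\gamma)$, $n\ge0$, be the generalized Dumont-Foata polynomials. Put $$\begin{aligned} a&=\tfrac12(\alpha+\bar\alpha+\beta-\bar\beta+\bar\gamma-\gamma),\\ b&=\tfrac12(\bar\alpha-\alpha+\beta+\bar\beta+\gamma-\bar\gamma),\\ c&=\tfrac12(\alpha-\bar\alpha-\beta+\bar\beta+\gamma+\bar\gamma),\\ d&=\alpha\bar\alpha+\alpha(\beta-\bar\beta)-\bar\alpha(\gamma-\bar\gamma)-a^2. \end{aligned}$$ Then $\{\Gamma_{n+1}(\alpha,\bar\alpha)\}_{n\ge0}$ is the moment sequence of the rescaled continuous dual Hahn polynomials $Z_n(x)=p_n(x+d;a,b,c)$. More precisely, let $\psi\colon K[x]\to K$ be the $K$-linear functional such that $\psi(x^n)=\Gamma_{n+1}(\alpha,\bar\alpha)$ for all $n\ge0$. Then for all $m,n\ge0$ $$\psi(Z_m(x)Z_n(x))=n!\,(\bar\alpha+\beta)_n(\alpha+\bar\gamma)_n(\bar\beta+\gamma)_n\,\delta_{mn},$$ where $$Z_n(x)=\sum_{k=0}^n(-1)^{n-k}\binom nk(\bar\alpha+\beta+k)_{n-k}(\alpha+\bar\gamma+k)_{n-k}\prod_{l=0}^{k-1}\left[x+(\alpha+l)(\bar\alpha+l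)+(\alpha+l)(\beta-\bar\beta)-(\bar\alpha+l)(\gamma-\bar\gamma)\right].$$
   Context: $(x)_n=x(x+1)\cdots(x+n-1)$, $(x)_0=1$; $\delta_{mn}$ is the Kronecker delta; the bars are part of the names of the variables (no conjugation). The J-fraction $J(t;a_1,b_1,a_2,b_2,\dots)$ is the formal power series in $t$ given by the continued fraction $$\cfrac{1}{1-a_1t-\cfrac{b_1t^2}{1-a_2t-\cfrac{b_2t^2}{1-\cdots}}}.$$ The generalized Dumont-Foata polynomials $\Gamma_{n+1}(\alpha,\bar\alpha)=\Gamma_{n+1}(\alpha,\bar\alpha,\beta,\bar\beta,\gamma,\bar\gamma)$ are defined by $$\sum_{n\ge0}\Gamma_{n+1}(\alpha,\bar\alpha)t^n=J(t;\,B_0,\Lambda_1,B_1,\Lambda_2,B_2,\ldots),$$ where, for $n\ge0$, $B_n=(\alpha+n)(\bar\beta+n)+(\beta+n)(\bar\gamma+n)+(\gamma+n)(\bar\alpha+n)-n(n+1)$ and $\Lambda_{n+1}=(n+1)(\bar\alpha+\beta+n)(\bar\beta+\gamma+n)(\bar\gamma+\alpha+n)$. The continuous dual Hahn polynomials $p_n(x)=p_n(x;a,b,c)$ are the (monic, degree $n$) polynomials in $x$ defined by $$p_n(x^2;a,b,c)=(-1)^n(a+b)_n(a+c)_n\,{}_3F_2\left(\begin{array}{c}-n,\ a+ix,\ a-ix\\ a+b,\ a+c\end{array};1\right),\qquad i^2=-1.$$ *)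

(* Defs.v *)
From HB Require Import structures.
From mathcomp Require Export all_boot all_order all_algebra all_field.
From mathcomp Require Export mpoly.
From Stdlib Require Import Classical.

Set Implicit Arguments.
Unset Strict Implicit.
Unset Printing Implicit Defensive.

Import Order.TTheory GRing.Theory Num.Theory.
Local Open Scope ring_scope.

Definition poch (R : pzRingType) (x : R) (n : nat) : R :=
  \prod_(l < n) (x + l%:R).

(* No nonzero polynomial relation with integer coefficients; in characteristic 0
   this is algebraic independence over the prime field. *)
Definition algebraically_independent (K : fieldType) (n : nat) (v : 'I_n -> K) :
    Prop :=
  forall q : {mpoly int[n]}, mmap intr v q = 0 -> q = 0.

(* A formal power series in t is the sequence of its coefficients. *)
Definition series (R : Type) := nat -> R.

Section JFraction.
Variable R : comNzRingType.
Implicit Types (f g u S : series R) (a b : nat -> R).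

Definition sone : series R := fun n => (n == 0)%:R.

Definition smul f g : series R := fun n => \sum_(i < n.+1) f i * g (n - i)%N.

(* 1 / (1 - u) for a series u with zero constant term: then u^k does not
   contribute to the coefficient of t^n when k > n. *)
Definition sgeom u : series R :=
  fun n => \sum_(k < n.+1) iter k (smul u) sone n.

(* x t + y t^2 S(t) *)
Definition jtail (x y : R) S : series R :=
  fun n => match n with 0 => 0 | 1 => x | m.+2 => y * S m end.

(* The N-th convergent, in which the continued fraction is cut after a_N. *)
Fixpoint Jconvergent (N : nat) a b : series R :=
  if N is N'.+1 then
    sgeom (jtail (a 0) (b 0)
             (Jconvergent N' (fun k => a k.+1) (fun k => b k.+1)))
  else fun=> 0.

(* J(t; a_1, b_1, a_2, b_2, ...) with a k = a_(k+1) and b k = b_(k+1), as the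
   t-adic limit of its convergents: by JconvergentE, the coefficient of t^n is
   the same in all the convergents of index greater than n. *)
Definition Jfraction a b : series R := fun n => Jconvergent n.+1 a b n.

Lemma iter_smul_gt u k n : u 0%N = 0 -> (n < k)%N -> iter k (smul u) sone n = 0.
Proof.
move=> u0; elim: k n => // k IHk n lt_nk /=.
rewrite /smul big_ord_recl u0 mul0r add0r big1 // => i _.
rewrite IHk ?mulr0 // lift0; case: i => i lt_in /=.
by rewrite (leq_trans _ (_ : n <= k)%N) // ltn_subrL (leq_trans _ lt_in).
Qed.

Lemma sgeomE u n : u 0%N = 0 -> sgeom u n = sone n + smul u (sgeom u) n.
Proof.
move=> u0; rewrite {1}/sgeom big_ord_recl /=; congr (_ + _).
rewrite {2}/smul /= /smul exchange_big /=; apply: eq_bigr => i _.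
rewrite -big_distrr /=; case: (posnP i) => [->|i_gt0]; first by rewrite u0 !mul0r.
congr (_ * _); rewrite /sgeom.
have le_in : (n - i < n)%N.
  by rewrite ltn_subrL i_gt0 (leq_trans i_gt0) // -ltnS.
rewrite -(big_mkord xpredT (fun k => iter k (smul u) sone (n - i)%N)).
rewrite -(big_mkord xpredT (fun k => iter k (smul u) sone (n - i)%N)).
rewrite (big_cat_nat _ (n := (n - i).+1)) //=.
rewrite [X in _ + X]big_nat_cond [X in _ + X]big1 ?addr0 // => k.
by rewrite andbT => /andP[lt_k _]; rewrite iter_smul_gt.
Qed.

Lemma eq_sgeom u v n :
  (forall m, (m <= n)%N -> u m = v m) -> sgeom u n = sgeom v n.
Proof.
move=> eq_uv; apply: eq_bigr => -[k /= _] _.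
elim: k n eq_uv => //= k IHk n eq_uv.
apply: eq_bigr => i _; rewrite eq_uv; last by rewrite -ltnS.
congr (_ * _).
by apply: IHk => m le_m; rewrite eq_uv // (leq_trans le_m) ?leq_subr.
Qed.

Lemma JconvergentE N a b n : (n < N)%N -> Jconvergent N a b n = Jfraction a b n.
Proof.
rewrite /Jfraction; have [m] := ubnP n.
elim: m n N a b => // m IHm n [//|N] a b lt_nm lt_nN /=.
apply: eq_sgeom => -[|[|k]] //= lt_kn; congr (_ * _).
have lt_km : (k < m)%N by apply: leq_trans (ltnW lt_kn) _.
by rewrite IHm ?(leq_trans (ltnW lt_kn)) // [RHS]IHm // ltnW.
Qed.

(* (1 - a_1 t - b_1 t^2 J(t; a_2, b_2, ...)) J(t; a_1, b_1, ...) = 1 *)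
Lemma JfractionE a b n :
  let J := Jfraction a b in
  let J' := Jfraction (fun k => a k.+1) (fun k => b k.+1) in
  J n = sone n + smul (jtail (a 0%N) (b 0%N) J') J n.
Proof.
move=> J J'; have EJ m : J m = sgeom (jtail (a 0%N) (b 0%N) J') m.
  rewrite /J /Jfraction /=; apply: eq_sgeom => -[|[|k]] //= lt_km.
  by rewrite JconvergentE // ltnW.
rewrite EJ sgeomE //; congr (_ + _); apply: eq_bigr => i _; by rewrite -EJ.
Qed.

End JFraction.

Section DumontFoata.
Variables (R : comNzRingType) (al al' be be' ga ga' : R).

Definition DF_B (n : nat) : R :=
  (al + n%:R) * (be' + n%:R) + (be + n%:R) * (ga' + n%:R)
  + (ga + n%:R) * (al' + n%:R) - (n * n.+1)%:R.

(* DF_Lambda n is Lambda_(n+1). *)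
Definition DF_Lambda (n : nat) : R :=
  n.+1%:R * (al' + be + n%:R) * (be' + ga + n%:R) * (ga' + al + n%:R).

(* Only DumontFoata n with n >= 1 is meaningful; DumontFoata n.+1 is the
   coefficient of t^n. *)
Definition DumontFoata (n : nat) : R := Jfraction DF_B DF_Lambda n.-1.

End DumontFoata.

(* The terminating series 3F2(-n, x, y; u, v; z): the terms of index k > n
   contain the factor (-n)_k = 0. *)
Definition F32 (F : fieldType) (n : nat) (x y u v z : F) : F :=
  \sum_(k < n.+1) poch (- n%:R) k * poch x k * poch y k
                  / (poch u k * poch v k * k`!%:R) * z ^+ k.

(* The coefficients of p n are in K, but i lives in an extension L of K; the
   defining identity is imposed at every x of L, which is infinite when K has
   characteristic 0. *)
Definition continuous_dual_Hahn (K : fieldType) (a b c : K)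
    (p : nat -> {poly K}) : Prop :=
  exists (L : fieldType) (iota : {rmorphism K -> L}) (i : L),
    i ^+ 2 = -1 /\
    forall (n : nat) (x : L),
      (map_poly iota (p n)).[x ^+ 2] =
      (-1) ^+ n * poch (iota (a + b)) n * poch (iota (a + c)) n
      * F32 n (iota a + i * x) (iota a - i * x) (iota (a + b)) (iota (a + c)) 1.

(* Orthogonality includes the usual requirements deg P_n = n and
   psi(P_n^2) != 0. *)
Definition moment_sequence (K : fieldType) (mu : nat -> K)
    (P : nat -> {poly K}) : Prop :=
  exists psi : {scalar {poly K}},
    [/\ forall n, psi 'X^n = mu n,
        forall n, size (P n) = n.+1,
        forall m n, m != n -> psi (P m * P n) = 0
      & forall n, psi (P n * P n) != 0].

Section DualHahnExistence.
Variable K : fieldType.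

Let explicit (a b c : K) (n : nat) : {poly K} :=
  ((-1) ^+ n * poch (a + b) n * poch (a + c) n) *:
  \sum_(k < n.+1) (poch (- n%:R) k / (poch (a + b) k * poch (a + c) k * k`!%:R))
    *: \prod_(l < k) ('X + ((a + l%:R) ^+ 2)%:P).

Let rmorph_poch (L : fieldType) (iota : {rmorphism K -> L}) x n :
  iota (poch x n) = poch (iota x) n.
Proof.
by rewrite rmorph_prod; apply: eq_bigr => l _; rewrite rmorphD rmorph_nat.
Qed.

Let explicitE (L : fieldType) (iota : {rmorphism K -> L}) (i : L) a b c n x :
  i ^+ 2 = -1 ->
  (map_poly iota (explicit a b c n)).[x ^+ 2] =
  (-1) ^+ n * poch (iota (a + b)) n * poch (iota (a + c)) n
  * F32 n (iota a + i * x) (iota a - i * x) (iota (a + b)) (iota (a + c)) 1.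
Proof.
move=> i2; rewrite /explicit map_polyZ hornerZ /=; congr (_ * _).
  by rewrite !rmorphM /= rmorphXn rmorphN1 !rmorph_poch.
rewrite rmorph_sum horner_sum; apply: eq_bigr => k _ /=.
rewrite map_polyZ hornerZ /= fmorph_div !rmorphM /= rmorph_nat !rmorph_poch.
rewrite rmorphN rmorph_nat expr1n mulr1 rmorph_prod horner_prod mulrAC.
congr (_ / _); rewrite -mulrA; congr (_ * _); rewrite -big_split /=.
apply: eq_bigr => l _; rewrite rmorphD /= map_polyX map_polyC /= hornerD hornerX.
rewrite hornerC rmorphXn rmorphD rmorph_nat.
have -> : x ^+ 2 = - (i * x) ^+ 2 by rewrite exprMn i2 mulN1r opprK.
by rewrite addrC subr_sqr mulrC [iota a + _ + _]addrAC [iota a - _ + _]addrAC.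
Qed.

Lemma sqrtN1_extension :
  exists (L : fieldType) (iota : {rmorphism K -> L}) (i : L), i ^+ 2 = -1.
Proof.
case: (classic (exists i : K, i ^+ 2 = -1)) => [[i i2]|no_i].
  by exists K, idfun, i.
have szp : size ('X^2 + 1 : {poly K}) = 3%N by rewrite size_XnaddC.
have irrp : irreducible_poly ('X^2 + 1 : {poly K}).
  apply: cubic_irreducible; first by rewrite szp.
  move=> x; apply/negP => /rootP; rewrite hornerD hornerXn hornerC => /eqP.
  by rewrite addr_eq0 => /eqP x2; case: no_i; exists x.
have [L _ [i root_i _]] := irredp_FAdjoin irrp.
exists L, (in_alg L), i; move/rootP: root_i.
rewrite rmorphD /= map_polyXn rmorph1 hornerD hornerXn hornerC => /eqP.
by rewrite addr_eq0 => /eqP.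
Qed.

Lemma continuous_dual_Hahn_exists (a b c : K) :
  exists p, continuous_dual_Hahn a b c p.
Proof.
have [L [iota [i i2]]] := sqrtN1_extension.
exists (explicit a b c), L, iota, i; split=> // n x; exact: explicitE.
Qed.

Lemma continuous_dual_Hahn_unique (a b c : K) (p q : nat -> {poly K}) :
  [pchar K] =i pred0 ->
  continuous_dual_Hahn a b c p -> continuous_dual_Hahn a b c q -> p =1 q.
Proof.
move=> charK; suff H r n : continuous_dual_Hahn a b c r -> r n = explicit a b c n.
  by move=> /H Hp /H Hq n; rewrite Hp Hq.
move=> [L [iota [i [i2 Er]]]]; apply/eqP; rewrite -subr_eq0.
rewrite -(map_poly_eq0 iota); apply: contraT => nz.
have inj_natr : injective (fun m => m%:R : L).
  have /GRing.pcharf0P char0 : [pchar L] =i pred0.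
    by move=> m; rewrite (fmorph_pchar iota) charK.
  suff le_eq m k : (m <= k)%N -> m%:R = k%:R :> L -> m = k.
    move=> m k eq_mk; case/orP: (leq_total m k) => [/le_eq->|/le_eq->] //.
  move=> le_mk /esym/eqP; rewrite -subr_eq0 -natrB // char0 subn_eq0 => le_km.
  by apply/eqP; rewrite eqn_leq le_mk.
set f := map_poly _ _ in nz.
set s := [seq (m%:R : L) ^+ 2 | m <- seq.iota 0 (size f)].
have rs : all (root f) s.
  apply/allP => _ /mapP[m _ ->]; rewrite /f rmorphB rootE hornerD hornerN.
  by rewrite Er (explicitE _ _ _ _ _ _ i2) subrr.
have us : uniq s.
  rewrite map_inj_uniq ?iota_uniq // => m k; rewrite -!natrX => /inj_natr/eqP.
  by rewrite eqn_exp2r // => /eqP.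
by have := max_poly_roots nz rs us; rewrite size_map size_iota ltnn.
Qed.

End DualHahnExistence.

(* Main.v *)
From HB Require Import structures.
Require Import Defs.
From mathcomp Require Import ring.

Set Implicit Arguments.
Unset Strict Implicit.
Unset Printing Implicit Defensive.

Import GRing.Theory.
Local Open Scope ring_scope.

(** The proof meets in the middle, at a three-term recurrence.

    On one side, let J_n be the J-fraction obtained by dropping the first n
    levels, so that J_n = 1 + B_n t J_n + Lambda_(n+1) t^2 J_(n+1) J_n, and let
    G_n = Lambda_1 ... Lambda_n t^n J_0 J_1 ... J_n ([path_series]).  Multiplying
    the equation of J_n by the remaining factors of G_n gives
    G_n = [n = 0] + t (G_(n+1) + B_n G_n + Lambda_n G_(n-1)).  If the moments of
    psi are the coefficients of J_0 and the polynomials Q_n satisfy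
    Q_(n+1) = (X - B_n) Q_n - Lambda_n Q_(n-1), then the series of the
    psi (X^k Q_n) satisfies the same relation with the same value at n = 0, so
    psi (X^k Q_n) is the coefficient of t^k in G_n ([scalar_Xn_mul]).  This is 0
    for k < n and Lambda_1 ... Lambda_n for k = n.  As Q_m is monic of degree m,
    orthogonality follows ([Jfraction_orthogonal]).

    On the other side, the 3F2 series expands the continuous dual Hahn
    polynomials in the Newton basis of the products of the X + (a + l)^2, and
    replacing X by X + d turns a^2 into
    e0 = al al' + al (be - be') - al' (ga - ga') in the nodes
    (a + l)^2 = a^2 + 2 a l + l^2.  In terms of u = a + b, v = a + c and w = b + c,
    where 2 a = u + v - w, the coefficients of this expansion satisfy an
    elementary recurrence ([hahn_coef_rec]), whence a three-term recurrence
    for the polynomials ([hahn_poly_rec]).  With u = al' + be, v = al + ga' and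
    w = be' + ga its parameters are exactly B_n and Lambda_n.

    Independence of the six parameters ensures that the Pochhammer symbols of
    u, v and w do not vanish: those of u and v are in the denominators of the
    3F2 series, and all three are factors of psi (Z_n^2). *)

(** * Products of power series *)

Section SeriesProduct.
Variable R : comNzRingType.
Implicit Types f g h : series R.

(** A coefficient of a product only involves a truncation of the factors, so the
    ring laws of polynomials carry over to series. *)
Lemma smul_coef f g N n : (n < N)%N ->
  smul f g n = ((\poly_(i < N) f i) * (\poly_(i < N) g i))`_n.
Proof.
move=> lt_nN; rewrite coefM; apply: eq_bigr => i _.
have le_in : (i <= n)%N by rewrite -ltnS.
by rewrite !coef_poly (leq_ltn_trans le_in) // (leq_ltn_trans (leq_subr _ _)).
Qed.

Lemma eq_smull f g h n : f =1 g -> smul f h n = smul g h n.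
Proof. by move=> eq_fg; apply: eq_bigr => i _; rewrite eq_fg. Qed.

Lemma smulA f g h n : smul f (smul g h) n = smul (smul f g) h n.
Proof.
have trunc (p q : {poly R}) : (forall i, (i <= n)%N -> p`_i = q`_i) ->
    forall r : {poly R}, (r * p)`_n = (r * q)`_n.
  move=> eq_pq r; rewrite !coefM.
  by apply: eq_bigr => i _; rewrite eq_pq ?leq_subr.
have prod f' g' i : (i <= n)%N -> (\poly_(i < n.+1) smul f' g' i)`_i =
    ((\poly_(i < n.+1) f' i) * (\poly_(i < n.+1) g' i))`_i.
  by move=> le_in; rewrite coef_poly ltnS le_in (@smul_coef _ _ n.+1).
rewrite !(@smul_coef _ _ n.+1) // (trunc _ _ (prod g h)) mulrA.
by rewrite ![_ * \poly_(_ < _) h _]mulrC (trunc _ _ (prod f g)).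
Qed.

Lemma smul1 f n : smul (sone R) f n = f n.
Proof.
rewrite /smul big_ord_recl /= mul1r subn0 big1 ?addr0 // => i _.
by rewrite /sone mul0r.
Qed.

Lemma smulDl f g h n : smul (fun m => f m + g m) h n = smul f h n + smul g h n.
Proof. by rewrite -big_split; apply: eq_bigr => i _; rewrite mulrDl. Qed.

Lemma smul_jtail x y S f k :
  smul (jtail x y S) f k.+1 = x * f k + \sum_(i < k) y * S i * f (k - i.+1)%N.
Proof.
by rewrite /smul !big_ord_recl mul0r add0r subn1.
Qed.

End SeriesProduct.

(** * Orthogonality from a J-fraction *)

Section OrthogonalPolynomials.
Variables (R : comNzRingType) (B L : nat -> R).

Definition tail (n : nat) (s : nat -> R) := iter n (fun s k => s k.+1) s.

Lemma tailE n s k : tail n s k = s (n + k)%N.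
Proof. by elim: n s k => //= n IHn s k; rewrite IHn addnS. Qed.

Definition Jtail n : series R := Jfraction (tail n B) (tail n L).

Definition prev_term (V : lmodType R) (f : nat -> V) (n : nat) : V :=
  if n is m.+1 then L m *: f m else 0.

(** The series t^n L_0 ... L_(n-1) J_0 ... J_n, where J_m is [Jtail m]; cutting
    paths at their last visits to the heights 0, ..., n - 1 shows that it
    enumerates the Motzkin paths from height 0 to height n, with weights B on
    level steps and L on up steps.  The second factor of the product is 1 for n = 0, and
    L_(n-1) t times the previous series otherwise. *)
Fixpoint path_series (n : nat) : series R :=
  smul (Jtail n) (fun k =>
    match n, k with
    | 0, _ => sone R k
    | m.+1, 0 => 0
    | m.+1, j.+1 => L m * path_series m j
    end).

Lemma path_series0 k : path_series 0 k = Jfraction B L k.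
Proof.
rewrite /= /smul big_ord_recr /= subnn mulr1 big1 ?add0r // => i _.
by rewrite /sone subn_eq0 leqNgt ltn_ord mulr0.
Qed.

Arguments path_series : simpl never.

Lemma path_series_conv n k : path_series n.+1 k =
  \sum_(i < k.+1) Jtail n.+1 i *
    (if (k - i)%N is j.+1 then L n * path_series n j else 0).
Proof. by []. Qed.

(** The equation J_n = 1 + B_n t J_n + L_n t^2 J_(n+1) J_n, multiplied by the
    other factors of the path series.  On paths, it removes the last step, which comes
    from height n + 1, n or n - 1. *)
Lemma path_seriesS n k : path_series n k.+1 =
  path_series n.+1 k + B n * path_series n k
  + prev_term (fun m => path_series m k : R^o) n.
Proof.
set H : series R := fun k =>
    match n, k with
    | 0, _ => sone R k
    | m.+1, 0 => 0
    | m.+1, j.+1 => L m * path_series m j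
    end.
have GE j : path_series n j = smul (Jtail n) H j by case: (n) @H.
have -> : prev_term (fun m => path_series m k : R^o) n = H k.+1.
  by rewrite /H; case: (n).
rewrite addrC GE (eq_smull _ _ (JfractionE _ _)) smulDl smul1; congr (_ + _).
rewrite -smulA smul_jtail !tailE addn0 -GE addrC; congr (_ + _).
rewrite path_series_conv big_ord_recr /= subnn mulr0 addr0.
apply: eq_bigr => i _; rewrite -[X in _ * X]GE -(subnSK (ltn_ord i)).
by rewrite mulrA [Jtail _ _ * _]mulrC.
Qed.

Lemma path_series_lt n k : (k < n)%N -> path_series n k = 0.
Proof.
elim: n k => // n IHn k lt_kn; rewrite path_series_conv; apply: big1 => i _.
case E: (k - i)%N => [|j]; rewrite ?mulr0 //.
rewrite IHn ?mulr0 //.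
by rewrite -ltnS -E (leq_ltn_trans (leq_subr _ _)).
Qed.

Lemma path_series_diag n : path_series n n = \prod_(i < n) L i.
Proof.
have J0 m : Jtail m 0%N = 1.
  by rewrite /Jtail JfractionE /smul big_ord1 mul0r addr0.
elim: n => [|n IHn]; first by rewrite path_series0 big_ord0; exact: (J0 0%N).
rewrite path_series_conv [LHS]big_ord_recl /= IHn J0 mul1r.
rewrite [RHS]big_ord_recr [RHS]mulrC [X in _ + X]big1 ?addr0 // => i _.
rewrite subSS.
case E: (n - i)%N => [|j]; rewrite ?mulr0 // path_series_lt ?mulr0 //.
by rewrite -E leq_subr.
Qed.

Variable Q : nat -> {poly R}.
Hypothesis Q0 : Q 0 = 1.
Hypothesis QS : forall n, Q n.+1 = 'X * Q n - B n *: Q n - prev_term Q n.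

(** The three-term recurrence makes the polynomials monic, with the n-th one of
    degree n. *)
Lemma recurrence_coef n :
  (Q n)`_n = 1 /\ forall i, (n < i)%N -> (Q n)`_i = 0.
Proof.
have [m le_nm] := ubnP n; elim: m n le_nm => // m IHm [|n] lt_nm.
  by rewrite Q0; split=> [|[|i]] //; rewrite coef1.
have [Qn Qn0] := IHm n lt_nm.
have prev0 i : (n < i)%N -> (prev_term Q n)`_i = 0.
  case: n lt_nm {Qn Qn0} => [|n] lt_nm lt_ni; rewrite ?coef0 //= coefZ.
  by have [_ ->] := IHm n (ltnW lt_nm); rewrite ?mulr0 // ltnW.
split=> [|[|i] // lt_ni]; rewrite QS !coefB coefXM coefZ /=.
  by rewrite prev0 // Qn Qn0 // mulr0 !subr0.
by rewrite !Qn0 ?prev0 ?mulr0 ?subr0 // ltnW.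
Qed.

Lemma size_recurrence n : size (Q n) = n.+1.
Proof.
have [Qn Qn0] := recurrence_coef n; apply/eqP; rewrite eqn_leq.
apply/andP; split; first by apply/leq_sizeP => i /Qn0.
rewrite ltnNge; apply/negP => /leq_sizeP/(_ n (leqnn n))/eqP.
by rewrite Qn oner_eq0.
Qed.

Variable psi : {scalar {poly R}}.
Hypothesis psiX : forall n, psi 'X^n = Jfraction B L n.

Lemma scalar_prev k n :
  psi ('X^k * prev_term Q n) = prev_term (fun m => psi ('X^k * Q m) : R^o) n.
Proof. by case: n => [|n] /=; rewrite ?mulr0 ?raddf0 // -scalerAr linearZ. Qed.

(** Both sides, as functions of k and n, are determined from their values at
    n = 0 by the same recurrence: [path_seriesS] gives the value at n.+1 from
    those at n and n - 1. *)
Lemma scalar_Xn_mul n k : psi ('X^k * Q n) = path_series n k.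
Proof.
have [m le_nm] := ubnP n; elim: m n k le_nm => // m IHm [|n] k lt_nm.
  by rewrite Q0 mulr1 psiX path_series0.
rewrite QS !mulrBr mulrA -exprSr -scalerAr !linearB linearZ scalar_prev /=.
rewrite !IHm // path_seriesS.
suff -> : prev_term (fun i => psi ('X^k * Q i) : R^o) n =
          prev_term (fun i => path_series i k : R^o) n.
  by rewrite addrAC !addrK.
by case: n lt_nm => //= n lt_nm; rewrite IHm // ltnW.
Qed.

(** The powers of X below the n-th are orthogonal to [Q n], because the n-th
    path series is divisible by t^n; only the coefficient of X^n survives. *)
Lemma scalar_mul_low (q : {poly R}) n : (size q <= n.+1)%N ->
  psi (q * Q n) = q`_n * \prod_(i < n) L i.
Proof.
move=> le_qn; rewrite -{1}(coefK q) (poly_def (size q)) mulr_suml linear_sum /=.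
rewrite (big_ord_widen n.+1 (fun i => psi (q`_i *: 'X^i * Q n))) // big_mkcond.
rewrite big_ord_recr /= big1 => [|i _]; last first.
  case: ifP => // _.
  by rewrite -scalerAl linearZ /= scalar_Xn_mul path_series_lt ?mulr0.
rewrite add0r -scalerAl linearZ /= scalar_Xn_mul path_series_diag.
by case: leqP => // le_qn'; rewrite nth_default ?mul0r.
Qed.

Lemma Jfraction_orthogonal m n :
  psi (Q m * Q n) = (m == n)%:R * \prod_(i < n) L i.
Proof.
wlog le_mn : m n / (m <= n)%N => [hwlog|].
  case: (leqP m n) => [|/ltnW] le; first exact: hwlog.
  rewrite mulrC hwlog // eq_sym; case: eqP => [->|] //.
  by rewrite !mul0r.
rewrite scalar_mul_low ?size_recurrence //; congr (_ * _).
case: eqP => [->|/eqP ne_mn]; first by case: (recurrence_coef n).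
by case: (recurrence_coef m) => _ ->; rewrite // ltn_neqAle ne_mn.
Qed.

End OrthogonalPolynomials.

Lemma scalar_of_moments (R : comNzRingType) (mu : nat -> R) :
  exists psi : {scalar {poly R}}, forall n, psi 'X^n = mu n.
Proof.
pose f (q : {poly R}) := \sum_(i < size q) q`_i * mu i.
have fE N (q : {poly R}) : (size q <= N)%N -> f q = \sum_(i < N) q`_i * mu i.
  move=> le_qN; rewrite /f (big_ord_widen N (fun i => q`_i * mu i)) //.
  rewrite big_mkcond; apply: eq_bigr => i _; case: ltnP => // le_qi.
  by rewrite nth_default // mul0r.
have linf : linear_for *%R f.
  move=> r q1 q2; set N := maxn (size q1) (size q2).
  have le1 : (size q1 <= N)%N by rewrite leq_maxl.
  have le2 : (size q2 <= N)%N by rewrite leq_maxr.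
  rewrite (fE N q1) // (fE N q2) // (fE N).
    rewrite mulr_sumr -big_split; apply: eq_bigr => i _ /=.
    by rewrite coefD coefZ mulrDl mulrA.
  rewrite (leq_trans (size_polyD _ _)) // geq_max le2 andbT.
  by rewrite (leq_trans (size_scale_leq _ _)).
pose fL := GRing.isLinear.Build R {poly R} R *%R f linf.
pose psi : {scalar {poly R}} := HB.pack f fL.
exists psi => n; rewrite /= (fE n.+1) ?size_polyXn // big_ord_recr /= coefXn.
rewrite eqxx mul1r big1 ?add0r // => i _.
by rewrite coefXn ltn_eqF ?mul0r.
Qed.

(** * Pochhammer symbols *)

Section PochhammerLemmas.
Variable R : comNzRingType.
Implicit Types x : R.

Lemma pochSr x n : poch x n.+1 = poch x n * (x + n%:R).
Proof. by rewrite /poch big_ord_recr. Qed.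

Lemma pochD x k j : poch x (k + j) = poch x k * poch (x + k%:R) j.
Proof.
rewrite /poch big_split_ord; congr (_ * _); apply: eq_bigr => i _ /=.
by rewrite natrD addrA.
Qed.

Lemma pochS x n : poch x n.+1 = x * poch (x + 1) n.
Proof. by rewrite -add1n pochD /poch big_ord1 addr0. Qed.

Lemma poch_oppr n k : poch (- n%:R : R) k = (-1) ^+ k * ('C(n, k) * k`!)%:R.
Proof.
rewrite bin_ffact.
elim: k => [|k IHk]; first by rewrite /poch big_ord0 mulr1.
rewrite pochSr IHk ffactnSr exprSr natrM.
have [lt_nk|le_kn] := ltnP n k; first by rewrite ffact_small // !(mulr0, mul0r).
by rewrite natrB //; ring.
Qed.

End PochhammerLemmas.

(** * Three-term recurrence of the dual Hahn polynomials *)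

Section NewtonForm.
Variable R : comNzRingType.

Definition newton_basis (e : nat -> R) (k : nat) : {poly R} :=
  \prod_(l < k) ('X + (e l)%:P).

Lemma newton_basisS e k :
  newton_basis e k.+1 = newton_basis e k * ('X + (e k)%:P).
Proof. by rewrite /newton_basis big_ord_recr. Qed.

Definition hahn_coef (u v : R) (n k : nat) : R :=
  (-1) ^+ (n - k) * 'C(n, k)%:R
  * poch (u + k%:R) (n - k) * poch (v + k%:R) (n - k).

(** For u = a + b, v = a + c and e l = (a + l)^2, these are the monic continuous
    dual Hahn polynomials ([hahn_poly_dual_Hahn]); adding a constant to all the
    e l translates the variable. *)
Definition hahn_poly (u v : R) (e : nat -> R) (n : nat) : {poly R} :=
  \sum_(k < n.+1) hahn_coef u v n k *: newton_basis e k.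

Variables u v w e0 : R.

(** With u = a + b, v = a + c, w = b + c, one has u + v - w = 2 a, so
    these are the squares (a + l)^2 with their constant term a^2 replaced by
    e0. *)
Definition hahn_node (l : nat) : R := e0 + l%:R * (u + v - w) + l%:R ^+ 2.
Definition hahn_B (n : nat) : R :=
  (u + n%:R) * (v + n%:R) + n%:R * (w + n%:R - 1) - e0.
Definition hahn_L (n : nat) : R :=
  n.+1%:R * (u + n%:R) * (w + n%:R) * (v + n%:R).

Let c := hahn_coef u v.

Lemma hahn_coef_gt n k : (n < k)%N -> c n k = 0.
Proof. by move=> lt_nk; rewrite /c /hahn_coef bin_small // mulr0 !mul0r. Qed.

(** This compares the coefficients of the k-th Newton basis element on both
    sides of the three-term recurrence; the left side is the coefficient in X
    times the n-th polynomial.  For k <= n, all terms are multiples of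
    E = (-1)^(n-k) (u+k)_(n-k) (v+k)_(n-k).  Dividing by E leaves an identity
    of polynomials if k = 0, and otherwise a multiple of
    (n - k + 1) C(n, k - 1) - k C(n, k) = 0. *)
Lemma hahn_coef_rec n k :
  (if k is j.+1 then c n j else 0) - hahn_node k * c n k =
  c n.+1 k + hahn_B n * c n k + prev_term hahn_L (fun m => c m k : R^o) n.
Proof.
have [lt_nk|le_kn] := ltnP n k.
  rewrite [c n k]hahn_coef_gt //.
  have -> : prev_term hahn_L (fun m => c m k : R^o) n = 0.
    case: n lt_nk => //= n lt_nk; rewrite hahn_coef_gt ?scaler0 //.
    exact: ltnW.
  case: k lt_nk => // k; rewrite ltnS leq_eqVlt => /orP[/eqP->|lt_nk].
    by rewrite /c /hahn_coef !subnn !binn /poch !big_ord0; ring.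
  by rewrite !hahn_coef_gt //; ring.
set E := (-1) ^+ (n - k) * poch (u + k%:R) (n - k) * poch (v + k%:R) (n - k).
have cnk : c n k = 'C(n, k)%:R * E by rewrite /c /hahn_coef /E; ring.
have cSnk : c n.+1 k = - ('C(n.+1, k)%:R * (u + n%:R) * (v + n%:R) * E).
  rewrite /c /hahn_coef /E subSn // !pochSr exprS natrB //; ring.
have cprev : (if k is j.+1 then c n j else 0) = - (
    (if k is j.+1 then 'C(n, j)%:R else 0)
    * (u + k%:R - 1) * (v + k%:R - 1) * E).
  case: k le_kn @E {cnk cSnk} => [|k] le_kn; first by rewrite /= !mul0r oppr0.
  rewrite /c /hahn_coef /=.
  have -> : (n - k = (n - k.+1).+1)%N by rewrite subnSK.
  rewrite !pochS exprS.
  have sh x : x + k%:R + 1 = x + k.+1%:R :> R by rewrite -addrA -natr1.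
  by rewrite !sh -!natr1; ring.
have cpred : prev_term hahn_L (fun m => c m k : R^o) n =
    - ((n%:R - k%:R) * 'C(n, k)%:R * (w + n%:R - 1) * E).
  case: n le_kn @E {cnk cSnk cprev} => [|n] le_kn /=.
    by move: le_kn; rewrite leqn0 => /eqP-> ; ring.
  move: le_kn; rewrite leq_eqVlt => /orP[/eqP->|le_kn].
    by rewrite hahn_coef_gt // scaler0; ring.
  have binE : (n.+1%:R - k%:R) * 'C(n.+1, k)%:R = n.+1%:R * 'C(n, k)%:R :> R.
    by rewrite -natrB ?(ltnW le_kn) // -!natrM -mul_bin_down.
  rewrite binE /c /hahn_coef /hahn_L /GRing.scale /= subSn // !pochSr exprS.
  have addE x : x + k%:R + (n - k)%:R = x + n%:R :> R.
    by rewrite natrB //; ring.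
  by rewrite !addE -!natr1; ring.
rewrite cprev cpred cnk cSnk /hahn_B /hahn_node.
case: k le_kn @E {cnk cSnk cprev cpred} => [|k] le_kn E.
  by rewrite !bin0; ring.
have binE : (n%:R - k%:R) * 'C(n, k)%:R = k.+1%:R * 'C(n, k.+1)%:R :> R.
  by rewrite -natrB ?(ltnW le_kn) // -!natrM mul_bin_left mulnC.
rewrite binS natrD -!natr1.
rewrite -natr1 in binE.
set X := 'C(n, k)%:R in binE *; set Y := 'C(n, k.+1)%:R in binE *.
apply/eqP; rewrite -subr_eq0; apply/eqP.
(* The difference of the two sides vanishes by the binomial identity alone, with
   this cofactor. *)
transitivity (((n%:R - k%:R) * X - (k%:R + 1) * Y)
              * (u + v + n%:R + k%:R) * E); first by ring.
by rewrite binE; ring.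
Qed.

Let Q := hahn_poly u v hahn_node.

Lemma hahn_poly_widen N n : (n < N)%N ->
  Q n = \sum_(k < N) c n k *: newton_basis hahn_node k.
Proof.
move=> lt_nN; rewrite /Q /hahn_poly.
rewrite (big_ord_widen N (fun k => c n k *: newton_basis hahn_node k)) //.
rewrite big_mkcond; apply: eq_bigr => k _; case: ltnP => // le_nk.
by rewrite hahn_coef_gt // scale0r.
Qed.

Lemma hahn_poly0 : Q 0 = 1.
Proof.
rewrite /Q /hahn_poly big_ord1 /newton_basis /hahn_coef /poch !big_ord0.
by rewrite bin0 !mulr1 scale1r.
Qed.

(** Multiplication by X acts on the Newton basis phi_k by
    X phi_k = phi_(k+1) - e_k phi_k, which turns the statement into
    [hahn_coef_rec]. *)
Lemma hahn_poly_rec n :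
  Q n.+1 = 'X * Q n - hahn_B n *: Q n - prev_term hahn_L Q n.
Proof.
have XQ : 'X * Q n = \sum_(k < n.+2)
    ((if (k : nat) is j.+1 then c n j else 0) - hahn_node k * c n k)
      *: newton_basis hahn_node k.
  under eq_bigr do rewrite scalerBl.
  rewrite sumrB big_ord_recl scale0r add0r mulr_sumr [X in _ - X]big_ord_recr /=.
  rewrite (hahn_coef_gt (ltnSn n)) mulr0 scale0r addr0 -sumrB.
  apply: eq_bigr => k _.
  rewrite /= -[bump 0 k]/(k.+1) newton_basisS.
  rewrite -scalerAr mulrC mulrDr scalerDr.
  have -> : hahn_node k * c n k = c n k * hahn_node k by rewrite mulrC.
  rewrite -(scalerA (c n k)) -(mul_polyC (hahn_node k)).
  by rewrite [(hahn_node k)%:P * _]mulrC addrK.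
have prevQ : prev_term hahn_L Q n =
    \sum_(k < n.+2) prev_term hahn_L (fun m => c m k : R^o) n
      *: newton_basis hahn_node k.
  case: n {XQ} => [|n] /=.
    by rewrite big1 // => k _; rewrite scale0r.
  rewrite (@hahn_poly_widen n.+3 n) ?scaler_sumr; last exact: ltnW.
  by apply: eq_bigr => k _; rewrite scalerA.
rewrite XQ prevQ (hahn_poly_widen (N := n.+2) (n := n)) //.
rewrite (hahn_poly_widen (N := n.+2) (n := n.+1)) //.
rewrite scaler_sumr -!sumrB; apply: eq_bigr => k _.
rewrite hahn_coef_rec scalerA -!scalerBl; congr (_ *: _); ring.
Qed.

End NewtonForm.

(** * The hypergeometric form *)

Lemma eq_hahn_poly (R : comNzRingType) (u v : R) e e' n :
  e =1 e' -> hahn_poly u v e n = hahn_poly u v e' n.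
Proof.
move=> eq_e; apply: eq_bigr => k _; congr (_ *: _).
by apply: eq_bigr => l _; rewrite eq_e.
Qed.

Lemma hahn_poly_shift (R : comNzRingType) (u v d : R) e n :
  hahn_poly u v e n \Po ('X + d%:P) = hahn_poly u v (fun l => d + e l) n.
Proof.
rewrite /hahn_poly linear_sum /=; apply: eq_bigr => k _.
rewrite linearZ /= /newton_basis rmorph_prod /=; congr (_ *: _).
apply: eq_bigr => l _.
by rewrite comp_polyD comp_polyX comp_polyC polyCD addrA.
Qed.

Lemma rmorph_poch (R S : pzRingType) (f : {rmorphism R -> S}) x n :
  f (poch x n) = poch (f x) n.
Proof.
by rewrite rmorph_prod; apply: eq_bigr => l _; rewrite rmorphD rmorph_nat.
Qed.

Lemma rmorph_hahn_coef (R S : comNzRingType) (f : {rmorphism R -> S}) u v n k :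
  f (hahn_coef u v n k) = hahn_coef (f u) (f v) n k.
Proof.
rewrite !rmorphM /= rmorphXn rmorphN1 !rmorph_poch.
by rewrite !rmorphD !rmorph_nat.
Qed.

(** Each pair of factors is (s + l)^2 - (i x)^2. *)
Lemma poch_conj (R : comNzRingType) (s i x : R) n : i ^+ 2 = -1 ->
  poch (s + i * x) n * poch (s - i * x) n
  = \prod_(l < n) (x ^+ 2 + (s + l%:R) ^+ 2).
Proof.
move=> i2; rewrite -big_split; apply: eq_bigr => l _ /=.
transitivity ((s + l%:R) ^+ 2 - i ^+ 2 * x ^+ 2); first by ring.
by rewrite i2; ring.
Qed.

(** The coefficient of the 3F2 series, cleared of its denominators: (x)_n splits
    as (x)_k (x + k)_(n-k), and (-n)_k = (-1)^k k! C(n, k). *)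
Lemma hahn_coefE (F : fieldType) (u v : F) n k : (k <= n)%N ->
  poch u k != 0 -> poch v k != 0 -> k`!%:R != 0 :> F ->
  (-1) ^+ n * poch u n * poch v n
    * (poch (- n%:R) k / (poch u k * poch v k * k`!%:R))
  = hahn_coef u v n k.
Proof.
move=> le_kn uk vk k_fact; rewrite poch_oppr natrM /hahn_coef.
have sgnE : (-1) ^+ n * (-1) ^+ k = (-1) ^+ (n - k) :> F.
  by rewrite -{1}(subnK le_kn) exprD -mulrA -expr2 sqrr_sign mulr1.
rewrite -sgnE -{2 3}(subnKC le_kn) !pochD.
by field; rewrite uk vk k_fact.
Qed.

Lemma hahn_poly_dual_Hahn (K : fieldType) (a b c : K) :
  [pchar K] =i pred0 ->
  (forall n, poch (a + b) n != 0) -> (forall n, poch (a + c) n != 0) ->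
  continuous_dual_Hahn a b c
    (hahn_poly (a + b) (a + c) (fun l => (a + l%:R) ^+ 2)).
Proof.
move=> charK ab_neq0 ac_neq0.
have [L [iota [i i2]]] := sqrtN1_extension K; exists L, iota, i; split=> // n x.
rewrite /hahn_poly rmorph_sum horner_sum /F32 mulr_sumr.
apply: eq_bigr => -[k /= le_kn] _; rewrite ltnS in le_kn.
rewrite map_polyZ hornerZ /= rmorph_hahn_coef -hahn_coefE //; last first.
- have /pcharf0P -> : [pchar L] =i pred0.
    by move=> m; rewrite (fmorph_pchar iota) charK.
  by rewrite -lt0n fact_gt0.
- by rewrite -rmorph_poch fmorph_eq0.
- by rewrite -rmorph_poch fmorph_eq0.
rewrite -!mulrA expr1n mulr1; do 4!congr (_ * _).
rewrite /newton_basis rmorph_prod horner_prod [LHS]mulrC [RHS]mulrA poch_conj //.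
congr (_ * _); apply: eq_bigr => l _.
rewrite rmorphD /= map_polyX map_polyC /= hornerD hornerX hornerC.
by rewrite rmorphXn rmorphD rmorph_nat.
Qed.

(** The polynomial X_i + X_j + l has coefficient 1 at X_i, hence is not zero. *)
Lemma algebraically_independent_sum (K : fieldType) n (v : 'I_n -> K) i j l :
  algebraically_independent v -> i != j -> v i + v j + l%:R != 0.
Proof.
move=> indep ne_ij; apply/eqP => sum0.
have /(congr1 (mcoeff U_(i))) : 'X_i + 'X_j + l%:R = 0 :> {mpoly int[n]}.
  by apply: indep; rewrite !rmorphD /= !mmapX !mmap1U rmorph_nat.
rewrite !mcoeffD mcoeffMn mcoeff1 !mcoeffXU eqxx eq_sym (negPf ne_ij) mcoeff0.
by rewrite mnm1_eq0 mul0rn.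
Qed.
(** * Moments of the rescaled continuous dual Hahn polynomials *)

Theorem theorem8 (K : fieldType) (charK : [pchar K] =i pred0)
  (al al' be be' ga ga' : K)
  (indep : algebraically_independent
             (tnth [tuple al; al'; be; be'; ga; ga']))
  (p : nat -> {poly K}) :
  let Gamma := DumontFoata al al' be be' ga ga' in
  let a := 2^-1 * (al + al' + be - be' + ga' - ga) in
  let b := 2^-1 * (al' - al + be + be' + ga - ga') in
  let c := 2^-1 * (al - al' - be + be' + ga + ga') in
  let d := al * al' + al * (be - be') - al' * (ga - ga') - a ^+ 2 in
  let Z := fun n : nat => p n \Po ('X + d%:P) in
  continuous_dual_Hahn a b c p ->
  [/\ moment_sequence (fun n => Gamma n.+1) Z,
      forall psi : {scalar {poly K}},
        (forall n : nat, psi 'X^n = Gamma n.+1) ->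
        forall m n : nat,
          psi (Z m * Z n) =
          n`!%:R * poch (al' + be) n * poch (al + ga') n * poch (be' + ga) n
          * (m == n)%:R
    & forall n : nat,
        Z n =
        \sum_(k < n.+1)
          ((-1) ^+ (n - k) * 'C(n, k)%:R
           * poch (al' + be + k%:R) (n - k) * poch (al + ga' + k%:R) (n - k))
          *: \prod_(l < k)
               ('X + ((al + l%:R) * (al' + l%:R) + (al + l%:R) * (be - be')
                      - (al' + l%:R) * (ga - ga'))%:P)].
Proof.
move=> Gamma a b c d Z p_Hahn.
have nat_neq0 n : (0 < n)%N -> n%:R != 0 :> K.
  by have /pcharf0P -> := charK; rewrite lt0n.
have two_neq0 := nat_neq0 2 isT.
have abE : a + b = al' + be by rewrite /a /b; field.
have acE : a + c = al + ga' by rewrite /a /c; field.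
pose u := al' + be; pose v := al + ga'; pose w := be' + ga.
(* Indices into the tuple of the six parameters. *)
pose o (m : nat) (lt_m6 : (m < 6)%N) := Ordinal lt_m6.
have sum_neq0 i j l := @algebraically_independent_sum K 6 _ i j l indep.
have poch_neq0 x n : (forall l, x + l%:R != 0 :> K) -> poch x n != 0.
  by move=> x_neq0; apply/prodf_neq0.
have u_neq0 l : u + l%:R != 0 by exact: (sum_neq0 (o 1 isT) (o 2 isT)).
have v_neq0 l : v + l%:R != 0 by exact: (sum_neq0 (o 0 isT) (o 5 isT)).
have w_neq0 l : w + l%:R != 0 by exact: (sum_neq0 (o 3 isT) (o 4 isT)).
pose e0 := al * al' + al * (be - be') - al' * (ga - ga').
have ZE n : Z n = hahn_poly u v (hahn_node u v w e0) n.
  have pE :=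
    continuous_dual_Hahn_unique charK p_Hahn (hahn_poly_dual_Hahn charK _ _).
  rewrite /Z pE ?abE ?acE => [|m|m]; try exact: poch_neq0.
  rewrite hahn_poly_shift; apply: eq_hahn_poly => l.
  by rewrite /d /hahn_node /e0 /u /v /w /a; field.
have BE n : DF_B al al' be be' ga ga' n = hahn_B u v w e0 n.
  by rewrite /DF_B /hahn_B /u /v /w /e0 natrM -natr1; ring.
have LE n : DF_Lambda al al' be be' ga ga' n = hahn_L u v w n.
  by rewrite /DF_Lambda /hahn_L /u /v /w; ring.
have prevE f n : prev_term (DF_Lambda al al' be be' ga ga') f n
    = prev_term (hahn_L u v w) f n :> {poly K} by case: n => //= n; rewrite LE.
have Z0 : Z 0 = 1 by rewrite ZE hahn_poly0.
have ZS n : Z n.+1 = 'X * Z n - DF_B al al' be be' ga ga' n *: Z n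
    - prev_term (DF_Lambda al al' be be' ga ga') Z n.
  rewrite prevE BE !ZE hahn_poly_rec; congr (_ - _).
  by case: n => //= n; rewrite ZE.
have prodL n : \prod_(l < n) DF_Lambda al al' be be' ga ga' l =
    n`!%:R * poch u n * poch v n * poch w n.
  elim: n => [|n IHn]; first by rewrite /poch !big_ord0 !mulr1.
  by rewrite big_ord_recr IHn /= LE !pochSr factS natrM /hahn_L; ring.
have orth (psi : {scalar {poly K}}) :
    (forall n : nat, psi 'X^n = Gamma n.+1) -> forall m n : nat,
    psi (Z m * Z n) =
    n`!%:R * poch u n * poch v n * poch w n * (m == n)%:R.
  by move=> psiX m n; rewrite (Jfraction_orthogonal Z0 ZS psiX) prodL mulrC.
split=> // [|n].
  have [psi psiX] := scalar_of_moments (fun n => Gamma n.+1).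
  exists psi; split=> // [n|m n ne_mn|n]; first exact: size_recurrence Z0 ZS n.
    by rewrite orth // (negPf ne_mn) mulr0.
  by rewrite orth // eqxx mulr1 !mulf_neq0 ?poch_neq0 // nat_neq0 ?fact_gt0.
rewrite ZE; apply: eq_bigr => k _; congr (_ *: _).
apply: eq_bigr => l _; congr (_ + _%:P).
by rewrite /hahn_node /e0 /u /v /w; ring.
Qed.
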